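(* For the SDE $dx_t=\mu(t,x_t)\,dt+g(t)\,dW_t$ on $[0,T]$ in $\mathbb R^d$ with spatially independent scalar diffusion coefficient $g$, the Euler–Maruyama scheme $$x_{k+1}=x_k+h\,\mu(t_k,x_k)+g(t_k)\,\Delta W_{t_k},\qquad \Delta W_{t_k}=W_{t_{k+1}}-W_{t_k},$$ is a strong Itô–Taylor scheme, and thus a general strong scheme, of order $\gamma=1$.
   Context: $W$ is a $d$-dimensional Wiener process, $\mu:[0,T]\times\mathbb R^d\to\mathbb R^d$ and $g:[0,T]\to\mathbb R$ are deterministic and smooth enough for the coefficient functions below to be defined; $t_k=kh$, $h=T/K$, $k=0,\dots,K$. $(\mathcal F_t)$ is the filtration generated by the initial value and $W$. Multi-indices $\alpha=(j_1,\dots,j_\ell)$, $j_i\in\{0,\dots,d\}$, together with the empty index $\nu$; $l(\alpha)=\ell$, $n(\alpha)$ = number of zero entries ($l(\nu)=n(\nu)=0$); $-\alpha$ (resp. $\alpha-$) deletes the first (resp. last) entry. $I_\nu[u]_{s,t}=u(t)$; for $\ell\ge1$, $I_\alpha[u]_{s,t}=\int_s^tI_{\alpha-}[u]_{s,r}\,dr$ if $j_\ell=0$ and $=\int_s^tI_{\alpha-}[u]_{s,r}\,dW^{(j_\ell)}_r$ if $j_\ell\ge1$, componentwise for vector-valued $u$; random vectors are regarded as time-constant integrands. With $L^0\varphi=\partial_t\varphi+\sum_i\mu_i\partial_{x_i}\varphi+\tfrac12g(t)^2\sum_i\partial_{x_i}^2\varphi$ and $L^r\varphi=g(t)\partial_{x_r}\varphi$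 ($r=1,\dots,d$), the coefficient functions $f_\alpha$ ($\mathbb R^d$-valued) are $f_\nu(t,x)=x$, $f_\alpha=L^{j_1}f_{-\alpha}$ (componentwise). $\mathcal A_\gamma=\{\alpha:l(\alpha)+n(\alpha)\le2\gamma\text{ or }l(\alpha)=n(\alpha)=\gamma+\tfrac12\}$. A strong Itô–Taylor scheme of order $\gamma$ is $x_{k+1}=x_k+\sum_{\alpha\in\mathcal A_\gamma\setminus\{\nu\}}I_\alpha[f_\alpha(t_k,x_k)]_{t_k,t_{k+1}}$. A general strong scheme of order $\gamma$ is an adapted scheme $x_{k+1}=x_k+\sum_{\alpha\in\mathcal A_\gamma\setminus\{\nu\}}I_\alpha[g_{\alpha,k}]_{t_k,t_{k+1}}+R_k$ with $\mathbb E[\max_{0\le k\le K-1}\|g_{\alpha,k}-f_\alpha(t_k,x_k)\|^2]\le Ch^{2\gamma-\phi(\alpha)}$, where $\phi(\alpha)=2(l(\alpha)-1)$ if $l(\alpha)=n(\alpha)$ and $\phi(\alpha)=l(\alpha)+n(\alpha)-1$ otherwise, and $R_k=R_k^M+R_k^D$ with $\mathbb E[R_k^M\mid\mathcal F_{t_k}]=0$ a.s., $\max_k\mathbb E\|R_k^M\|^2\le C_Rh^{2\gamma+1}$, $\max_k\mathbb E\|R_k^D\|^2\le C_Rh^{2\gamma+2}$, with constants $C,C_R$ independent of $h$. *)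

(* Defs.v *)
From HB Require Import structures.
From mathcomp Require Import all_boot all_order all_algebra.
From mathcomp Require Import all_classical all_reals all_analysis.
From mathcomp Require Import measurable_realfun.

Set Implicit Arguments.
Unset Strict Implicit.
Unset Printing Implicit Defensive.

Import Order.TTheory GRing.Theory Num.Theory.
Import numFieldNormedType.Exports.

Local Open Scope classical_set_scope.
Local Open Scope ring_scope.

(* A point of R^d is a row vector; [`|x|] on ['rV[R]_d] is the max norm, so the
   squared Euclidean norm is spelled out. *)
Definition sqnorm (R : realType) (d : nat) (x : 'rV[R]_d) : R :=
  \sum_(i < d) x ord0 i ^+ 2.

Definition borel_map (R : realType) (d : nat) (f : 'rV[R]_d -> 'rV[R]_d) :=
  forall (i : 'I_d) (B : set R), measurable B ->
    <<s @open 'rV[R]_d >> ((fun x => f x ord0 i) @^-1` B).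

Section Probability.
Context {R : realType} {dO : measure_display} {Omega : measurableType dO}.
Variable P : probability Omega R.

Definition random_vector (d : nat) (X : Omega -> 'rV[R]_d) :=
  forall i : 'I_d, measurable_fun setT (fun w => X w ord0 i).

Definition wrt (G : set (set Omega)) (X : Omega -> R) :=
  forall B : set R, measurable B -> G (X @^-1` B).

Definition vwrt (d : nat) (G : set (set Omega)) (X : Omega -> 'rV[R]_d) :=
  forall i : 'I_d, wrt G (fun w => X w ord0 i).

Definition is_cond_exp (G : set (set Omega)) (X Y : Omega -> R) :=
  [/\ P.-integrable setT (EFin \o X), P.-integrable setT (EFin \o Y), wrt G Y &
      forall A, G A ->
        (\int[P]_(w in A) (X w)%:E = \int[P]_(w in A) (Y w)%:E)%E].

(* Measurability is part of the definition since a measure takes unspecified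
   values on non-measurable sets. *)
Definition cvg0_in_probability (X : nat -> Omega -> \bar R) :=
  (forall n, measurable_fun setT (X n)) /\
  forall e : R, 0 < e -> P [set w | (e%:E <= X n w)%E] @[n --> \oo] --> 0%E.

Definition generated_filtration (d : nat) (x0 : Omega -> 'rV[R]_d)
    (W : R -> Omega -> 'rV[R]_d) (t : R) : set (set Omega) :=
  <<s [set A | exists (i : 'I_d) (B : set R), measurable B /\
        (A = (fun w => x0 w ord0 i) @^-1` B \/
         exists2 s : R, 0 <= s <= t & A = (fun w => W s w ord0 i) @^-1` B)] >>.

(* The product formula says at once that W_t - W_s is independent of F_s, that
   its coordinates are independent, and that each of them is N(0, t - s);
   [normal_prob] takes the standard deviation as its second parameter. *)
Definition wiener_process (d : nat) (F : R -> set (set Omega)) (T : R)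
    (W : R -> Omega -> 'rV[R]_d) :=
  [/\ forall t : R, 0 <= t <= T -> random_vector (W t) /\ vwrt (F t) (W t),
      {ae P, forall w, W 0 w = 0},
      {ae P, forall w, {within `[0, T], continuous (fun t => W t w)}} &
      forall s t : R, 0 <= s -> s < t -> t <= T ->
        forall (A : set Omega) (B : 'I_d -> set R),
          F s A -> (forall i, measurable (B i)) ->
          P (A `&` [set w | forall i, B i (W t w ord0 i - W s w ord0 i)]) =
          (P A * \prod_(i < d) normal_prob 0 (Num.sqrt (t - s)) (B i))%E].

Record simple_process := SimpleProcess {
  sp_size : nat;
  sp_time : nat -> R;
  sp_val : nat -> Omega -> R }.

Definition simple_on (F : R -> set (set Omega)) (s t : R)
    (H : simple_process) :=
  [/\ sp_time H 0 = s, sp_time H (sp_size H) = t &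
      forall i, (i < sp_size H)%N ->
        [/\ sp_time H i <= sp_time H i.+1,
            wrt (F (sp_time H i)) (sp_val H i) &
            exists M : R, forall w, `|sp_val H i w| <= M]].

Definition sp_eval (H : simple_process) (r : R) (w : Omega) : R :=
  \sum_(i < sp_size H)
     sp_val H i w * \1_(`]sp_time H i, sp_time H i.+1]%classic) r.

Definition sp_int (B : R -> Omega -> R) (H : simple_process) (w : Omega) : R :=
  \sum_(i < sp_size H)
     sp_val H i w * (B (sp_time H i.+1) w - B (sp_time H i) w).

(* Z is a version of the Ito integral of H with respect to B over [s, t], that
   is, the limit in probability of the elementary integrals of adapted simple
   processes H_n such that int_s^t (H_n - H)^2 dr tends to 0 in probability.
   When B is a Wiener process for the filtration F such a Z is unique up to a
   null set, and it exists for all progressively measurable H with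
   int_s^t H^2 dr finite almost surely. *)
Definition ito_integral (F : R -> set (set Omega)) (B H : R -> Omega -> R)
    (s t : R) (Z : Omega -> R) :=
  [/\ measurable_fun (`[s, t] `*` setT)
        (fun p : measurableTypeR R * Omega => H p.1 p.2),
      measurable_fun setT Z &
      exists Hn : nat -> simple_process,
        [/\ forall n, simple_on F s t (Hn n),
            cvg0_in_probability (fun n w =>
              \int[lebesgue_measure]_(r in `[s, t])
                 ((sp_eval (Hn n) r w - H r w) ^+ 2)%:E)%E &
            cvg0_in_probability (fun n w => (`|sp_int B (Hn n) w - Z w|)%:E)]].

Definition time_integral (H : R -> Omega -> R) (s t : R) (Z : Omega -> R) :=
  measurable_fun setT Z /\
  {ae P, forall w,
    lebesgue_measure.-integrable `[s, t] (fun r => (H r w)%:E) /\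
    Z w = \int[lebesgue_measure]_(r in `[s, t]) H r w}.

Section IteratedIntegrals.
Variables (d : nat) (F : R -> set (set Omega)) (W : R -> Omega -> 'rV[R]_d).

(* [iterated u s t al Y]: on [s, t], the process Y is a version of
   r |-> I_al[u]_{s,r}. In a multi-index, the letter [ord0] stands for dr and
   [lift ord0 j] for dW^(j); [rcons al j] has last letter j, and deleting it
   gives al. The versions of integrals are chosen with continuous paths, which
   makes them unique up to indistinguishability. *)
Inductive iterated (u : R -> Omega -> 'rV[R]_d) (s t : R) :
    seq 'I_d.+1 -> (R -> Omega -> 'rV[R]_d) -> Prop :=
| iterated_nil : iterated u s t [::] u
| iterated_time al (Y Z : R -> Omega -> 'rV[R]_d) :
    iterated u s t al Y ->
    (forall w, {within `[s, t], continuous (fun r => Z r w)}) ->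
    (forall r, s <= r <= t -> forall i : 'I_d,
       time_integral (fun q w => Y q w ord0 i) s r (fun w => Z r w ord0 i)) ->
    iterated u s t (rcons al ord0) Z
| iterated_ito al (j : 'I_d) (Y Z : R -> Omega -> 'rV[R]_d) :
    iterated u s t al Y ->
    (forall w, {within `[s, t], continuous (fun r => Z r w)}) ->
    (forall r, s <= r <= t -> forall i : 'I_d,
       ito_integral F (fun q w => W q w ord0 j) (fun q w => Y q w ord0 i) s r
         (fun w => Z r w ord0 i)) ->
    iterated u s t (rcons al (lift ord0 j)) Z.

(* J is a version of the random vector I_al[v]_{s,t}, v a random vector. *)
Definition multiple_ito (al : seq 'I_d.+1) (v : Omega -> 'rV[R]_d) (s t : R)
    (J : Omega -> 'rV[R]_d) :=
  exists2 Y, iterated (fun=> v) s t al Y & {ae P, forall w, J w = Y t w}.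

End IteratedIntegrals.
End Probability.

Section Coefficients.
Context {R : realType} (d : nat).
Variables (T : R) (mu : R -> 'rV[R]_d -> 'rV[R]_d) (g : R -> R).
Implicit Types phi : R -> 'rV[R]_d -> R.

Definition unit_vec (i : 'I_d) : 'rV[R]_d := delta_mx ord0 i.

(* The time derivative is taken within [0, T], hence one-sided at 0 and T. *)
Definition partial_t phi (t : R) (x : 'rV[R]_d) : R :=
  lim ((s - t)^-1 * (phi s x - phi t x) @[s --> within `[0, T] t^']).

Definition partial_x phi (i : 'I_d) (t : R) (x : 'rV[R]_d) : R :=
  'D_(unit_vec i) (phi t) x.

Definition L_zero phi : R -> 'rV[R]_d -> R := fun t x =>
  partial_t phi t x + \sum_(i < d) mu t x ord0 i * partial_x phi i t x
  + 2^-1 * g t ^+ 2 * \sum_(i < d) partial_x (partial_x phi i) i t x.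

Definition L_noise (r : 'I_d) phi : R -> 'rV[R]_d -> R := fun t x =>
  g t * partial_x phi r t x.

Definition L_op (j : 'I_d.+1) phi : R -> 'rV[R]_d -> R :=
  if unlift ord0 j is Some r then L_noise r phi else L_zero phi.

Definition coef (al : seq 'I_d.+1) (t : R) (x : 'rV[R]_d) : 'rV[R]_d :=
  \row_i foldr L_op (fun _ y => y ord0 i) al t x.

End Coefficients.

Section MultiIndices.
Context {R : realType} {d : nat}.
Implicit Types al : seq 'I_d.+1.

Definition nzeros al : nat := count_mem ord0 al.

Definition index_set (gamma : R) : set (seq 'I_d.+1) :=
  [set al | (size al + nzeros al)%:R <= 2 * gamma \/
            size al = nzeros al /\ (size al)%:R = gamma + 2^-1].

(* Only used for nonempty multi-indices. *)
Definition phi_exp al : R :=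
  if size al == nzeros al then 2 * ((size al)%:R - 1)
  else (size al + nzeros al)%:R - 1.

End MultiIndices.

Section Schemes.
Context {R : realType} {dO : measure_display} {Omega : measurableType dO}.
Variable P : probability Omega R.
Variables (d : nat) (F : R -> set (set Omega)) (T : R).
Variables (W : R -> Omega -> 'rV[R]_d).
Variables (mu : R -> 'rV[R]_d -> 'rV[R]_d) (g : R -> R).

Definition step (K : nat) : R := T / K%:R.
Definition grid (K k : nat) : R := k%:R * step K.

(* [x K k] is the k-th iterate on the grid with K steps: the constants in the
   definition of a general scheme are uniform in K. *)
Implicit Types x : nat -> nat -> Omega -> 'rV[R]_d.

Definition adapted_scheme x :=
  forall K k, (0 < K)%N -> (k <= K)%N -> vwrt (F (grid K k)) (x K k).

Definition strong_ito_taylor_scheme (gamma : R) x :=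
  adapted_scheme x /\
  forall K, (0 < K)%N ->
  exists J : seq 'I_d.+1 -> nat -> Omega -> 'rV[R]_d,
  forall k, (k < K)%N ->
    (forall al, (index_set gamma `\ [::]) al ->
       multiple_ito P F W al (fun w => coef T mu g al (grid K k) (x K k w))
         (grid K k) (grid K k.+1) (J al k)) /\
    {ae P, forall w, x K k.+1 w =
       x K k w + \sum_(al \in index_set gamma `\ [::]) J al k w}.

Definition general_strong_scheme (gamma : R) x :=
  adapted_scheme x /\
  exists C CR : R, forall K, (0 < K)%N ->
  exists (G J : seq 'I_d.+1 -> nat -> Omega -> 'rV[R]_d)
         (RM RD : nat -> Omega -> 'rV[R]_d),
  [/\ forall k, (k < K)%N ->
        [/\ forall al, (index_set gamma `\ [::]) al ->
              vwrt (F (grid K k)) (G al k) /\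
              multiple_ito P F W al (G al k) (grid K k) (grid K k.+1) (J al k),
            vwrt (F (grid K k.+1)) (RM k), vwrt (F (grid K k.+1)) (RD k),
            {ae P, forall w, x K k.+1 w =
               x K k w + \sum_(al \in index_set gamma `\ [::]) J al k w
               + (RM k w + RD k w)} &
            forall i : 'I_d, is_cond_exp P (F (grid K k))
              (fun w => RM k w ord0 i) (cst 0)],
      forall al, (index_set gamma `\ [::]) al ->
        ('E_P[(fun w => \big[Num.max/0%R]_(k < K)
               sqnorm (G al k w - coef T mu g al (grid K k) (x K k w)))%R]
         <= (C * step K `^ (2 * gamma - phi_exp al))%:E)%E,
      (\big[maxe/0]_(k < K) 'E_P[(fun w => sqnorm (RM k w))]
       <= (CR * step K `^ (2 * gamma + 1))%:E)%E &
      (\big[maxe/0]_(k < K) 'E_P[(fun w => sqnorm (RD k w))]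
       <= (CR * step K `^ (2 * gamma + 2))%:E)%E].

Fixpoint euler_maruyama (x0 : Omega -> 'rV[R]_d) (K k : nat) (w : Omega) :
    'rV[R]_d :=
  if k is k'.+1 then
    let y := euler_maruyama x0 K k' w in
    y + step K *: mu (grid K k') y
    + g (grid K k') *: (W (grid K k'.+1) w - W (grid K k') w)
  else x0 w.

End Schemes.

(* Main.v *)
Require Import Defs.
From mathcomp Require Import all_boot all_order all_algebra.
From mathcomp Require Import all_classical all_reals all_analysis.
From mathcomp Require Import measurable_realfun.
Import Order.TTheory GRing.Theory Num.Theory.
Import numFieldNormedType.Exports.
Local Open Scope classical_set_scope.
Local Open Scope ring_scope.

(** The multi-indices of order 1 other than the empty one are the single
    letters and the pairs of two noise letters ([index_set1P]).  Because g does
    not depend on x, applying L^j to a coordinate function gives a function of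
    time alone, which a further L^i annihilates: the coefficient of every pair
    of noise letters vanishes ([coef_noise2]).  The Milstein correction is
    therefore zero and only the letters remain, with coefficients mu for dr
    ([coef_time]) and g(t) e_j for dW^(j) ([coef_noise]).

    In the scheme these coefficients are frozen at the beginning of a step, so
    that they are random vectors constant in time and known at that moment.  The
    iterated integrals of such integrands are explicit: (t - s) v for dr
    ([multiple_ito_time]), and (W_t - W_s)_j v for dW^(j)
    ([multiple_ito_noise]).  Summing them reproduces one Euler-Maruyama step
    ([sum_euler_term]), so the scheme is the Taylor scheme of order 1.  It is a
    general scheme of order 1 with the exact coefficients as integrands and with
    zero remainders, so both constants can be taken to be 0.

    Three points need care.  The random vector v may be unbounded, whereas simple
    processes are bounded: the stochastic integral is reached through the
    processes with the single value v clamped to [-n, n], and convergence in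
    probability holds because P(|v| > n) tends to 0 ([ito_integral_cst]).  The
    versions of the integrals must have all their paths continuous, while the
    paths of W are only almost surely continuous: the version is set to 0 on a
    measurable null set.  Finally, mu(t, .) is Borel for the sigma-algebra of the
    open sets of R^d while random vectors are measurable coordinate by
    coordinate; the two agree because R^d has a countable base of boxes
    ([rV_measurable_open]). *)

(** * Coefficient functions of order 1 *)

(** A limit of a constant is that constant only along a proper filter: the
    point is that [t] is an accumulation point of [[0, T]], endpoints
    included. *)
Lemma partial_t_indep {R : realType} {d : nat} (T t : R)
    (f : 'rV[R]_d -> R) (x : 'rV[R]_d) :
  0 < T -> 0 <= t <= T -> partial_t T (fun=> f) t x = 0.
Proof.
move=> T0 /andP[t0 tT]; rewrite /partial_t.
suff PF : ProperFilter (within `[0, T] t^').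
  apply: lim_near_cst; first exact: Rhausdorff.
  by apply: nearW => s; rewrite subrr mulr0.
split; last exact: within_filter.
rewrite /within/= => /nbhs_ballP[e/= e0 /=].
have [tltT|] := ltP t T.
  (* A point of the interval to the right of t and closer to t than e. *)
  pose s := Num.min T (t + e / 2); move/(_ s).
  have ts : t < s by rewrite lt_min tltT ltrDl divr_gt0.
  apply; last 2 first.
  - by rewrite gt_eqF.
  - by rewrite /= in_itv/= (le_trans t0 (ltW ts))/= ge_min lexx.
  rewrite /ball/= ltr0_norm ?subr_lt0// opprB ltrBlDr gt_min; apply/orP; right.
  by rewrite addrC ltrD2r gtr_pMr ?invf_lt1 ?ltr1n.
move=> Tt; have -> : t = T by apply/eqP; rewrite eq_le tT.
(* At the right endpoint the neighbouring point is taken on the left. *)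
pose s := Num.max 0 (T - e / 2); move/(_ s).
have sT : s < T by rewrite gt_max T0 gtrBl divr_gt0.
apply; last 2 first.
- by rewrite lt_eqF.
- by rewrite /= in_itv/= (ltW sT) le_max lexx.
rewrite /ball/= gtr0_norm ?subr_gt0// ltrBlDr addrC -ltrBlDr lt_max; apply/orP; right.
by rewrite ltrD2l ltrN2 gtr_pMr ?invf_lt1 ?ltr1n.
Qed.

Lemma partial_x_coord {R : realType} {d : nat} (i j : 'I_d) :
  partial_x (fun (_ : R) (y : 'rV[R]_d) => y ord0 i) j = (fun _ _ => (i == j)%:R).
Proof.
apply/funext => t; apply/funext => x.
rewrite /partial_x /derive; apply: lim_near_cst; first exact: Rhausdorff.
near=> h => /=; rewrite !mxE/= addrK.
rewrite -[LHS]/(h^-1 * (h * (i == j)%:R)) mulrA mulVf ?mul1r//.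
by near: h; exact: nbhs_dnbhs_neq.
Unshelve. all: by end_near. Qed.

Lemma partial_x_cst {R : realType} {d : nat} (c : R -> R) (j : 'I_d) :
  partial_x (fun t (_ : 'rV[R]_d) => c t) j = (fun _ _ => 0).
Proof. by apply/funext => t; apply/funext => x; exact: derive_cst. Qed.

Section Coef.
Context {R : realType} {d : nat}.
Variables (T : R) (mu : R -> 'rV[R]_d -> 'rV[R]_d) (g : R -> R).

Lemma coef_time (t : R) (x : 'rV[R]_d) :
  0 < T -> 0 <= t <= T -> coef T mu g [:: ord0] t x = mu t x.
Proof.
move=> T0 tT; apply/rowP => i; rewrite mxE/= /L_op unlift_none /L_zero.
rewrite partial_t_indep// add0r [X in _ + _ * X]big1 ?mulr0 ?addr0; last first.
  by move=> j _; rewrite partial_x_coord (partial_x_cst (fun=> _)).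
rewrite (bigD1 i)//= partial_x_coord eqxx mulr1 big1 ?addr0// => j ji.
by rewrite partial_x_coord eq_sym (negbTE ji) mulr0.
Qed.

Lemma L_noise_coord (i j : 'I_d) :
  L_op T mu g (lift ord0 j) (fun _ (y : 'rV[R]_d) => y ord0 i) =
  (fun t _ => g t * (i == j)%:R).
Proof.
apply/funext => t; apply/funext => x.
by rewrite /L_op liftK /L_noise partial_x_coord.
Qed.

Lemma coef_noise (j : 'I_d) (t : R) (x : 'rV[R]_d) :
  coef T mu g [:: lift ord0 j] t x = g t *: unit_vec j.
Proof. by apply/rowP => i; rewrite !mxE/= L_noise_coord. Qed.

(** The diffusion coefficient does not depend on the space variable, so the
    inner operator leaves nothing for the outer one to differentiate. *)
Lemma coef_noise2 (i j : 'I_d) (t : R) (x : 'rV[R]_d) :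
  coef T mu g [:: lift ord0 i; lift ord0 j] t x = 0.
Proof.
apply/rowP => k; rewrite !mxE/= L_noise_coord /L_op liftK /L_noise.
by rewrite partial_x_cst mulr0.
Qed.

End Coef.

(** The second clause of the definition of the index set would need a length
    equal to 3/2; the first one bounds the length by 2 and counts a zero letter
    twice, which rules out every pair that contains one. *)
Lemma index_set1P {R : realType} {d : nat} (al : seq 'I_d.+1) :
  (index_set (1 : R) `\ [::]) al <->
  (exists j, al = [:: j]) \/
  (exists i j : 'I_d, al = [:: lift ord0 i; lift ord0 j]).
Proof.
have no_half_integer : forall n m : nat, (n = m /\ n%:R = 1 + 2^-1 :> R) -> False.
  move=> n _ [_ /(congr1 (fun z => z * 2))]; rewrite mulrDl mulVf//.
  by rewrite mul1r -natrM natr1 => /eqP; rewrite eqr_nat; case: n => [|[|[|n]]].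
split.
- case=> -[|/no_half_integer//]; rewrite mulr1 ler_nat.
  case: al => [_ /(_ erefl)//|a [|b al]]; first by left; exists a.
  move=> + _; rewrite /nzeros /=.
  case: (unliftP ord0 a) => [i|] ->; last by case: (b == _); case: al.
  case: (unliftP ord0 b) => [j|] ->; last by case: al.
  by case: al => [_|//]; right; exists i, j.
- move=> [[j ->]|[i [j ->]]]; split => //; left; rewrite mulr1 ler_nat /nzeros/=.
    by case: (_ == _).
  by [].
Qed.

(** * Measurability of random vectors and adaptedness *)

(** An open set is the union of the boxes with rational centre and radius
    1/(n+1) that it contains, and there are countably many of them. *)
Lemma rV_measurable_open {R : realType} {d : nat} {dT : measure_display}
    {T : measurableType dT} (X : T -> 'rV[R]_d) :
  (forall i, measurable_fun setT (fun w => X w ord0 i)) ->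
  forall U : set 'rV[R]_d, open U -> measurable (X @^-1` U).
Proof.
move=> mX U oU.
pose box (qn : 'rV[rat]_d * nat) : set 'rV[R]_d :=
  [set y | forall i, ball (ratr (qn.1 ord0 i) : R) qn.2.+1%:R^-1 (y ord0 i)].
pose B qn := [set w | box qn `<=` U /\ box qn (X w)].
have -> : X @^-1` U = \bigcup_qn B qn.
  apply/seteqP; split=> [w /= Uw|w [qn _ [qU Xq]]]; last exact: qU.
  have /nbhs_ballP[e /= e0 eU] : nbhs (X w) U by exact: open_nbhs_nbhs.
  have [n ne] : exists n, n.+1%:R^-1 < e / 2.
    have e20 : 0 < e / 2 by rewrite divr_gt0.
    have := near_infty_natSinv_lt (PosNum e20).
    by case=> n _ /(_ n (leqnn n)) /= ne; exists n.
  have /choice[q qX] : forall i, exists q : rat,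
      ball (X w ord0 i) n.+1%:R^-1 (ratr q).
    move=> i; have [//||y [yX [q _ qy]]] :=
      @dense_rat R (ball (X w ord0 i) n.+1%:R^-1).
    - by exists (X w ord0 i); exact: ballxx.
    - exact: ball_open.
    by exists q; rewrite qy.
  exists ((\row_i q i)%R, n) => //; split=> [y qy|i /=]; last first.
    by rewrite mxE; apply: ball_sym.
  apply: eU; split=> // i j; rewrite !ord1.
  have qyj : ball (ratr (q j) : R) n.+1%:R^-1 (y ord0 j).
    by have := qy j; rewrite /= mxE.
  apply: le_ball (ball_triangle (qX j) qyj).
  by rewrite [e]splitr ltW// ltrD.
apply: countable_bigcupT_measurable => [|qn]; first exact: countableP.
have [qnU|qnU] := pselect (box qn `<=` U); last first.
  rewrite (_ : B qn = set0) ?measurable0//.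
  by apply/seteqP; split=> // w [].
rewrite (_ : B qn = \bigcap_i
    ((fun w => X w ord0 i) @^-1` ball (ratr (qn.1 ord0 i) : R) qn.2.+1%:R^-1)).
  apply: fin_bigcap_measurable => // i _.
  by rewrite -[X in measurable X]setTI; apply: mX => //; exact: measurable_ball.
apply/seteqP; split=> [w [_ qw] i _ |w qw]; first exact: qw.
by split=> // i; exact: (qw i).
Qed.

Lemma borel_map_measurable {R : realType} {d : nat} {dT : measure_display}
    {T : measurableType dT} (f : 'rV[R]_d -> 'rV[R]_d) (X : T -> 'rV[R]_d) :
  borel_map f ->
  (forall i, measurable_fun setT (fun w => X w ord0 i)) ->
  forall i, measurable_fun setT (fun w => f (X w) ord0 i).
Proof.
move=> bf mX i _ B mB; rewrite setTI.
pose S := [set A : set 'rV[R]_d | measurable (X @^-1` A)].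
suff : <<s @open 'rV[R]_d >> `<=` S by move=> /(_ _ (bf i B mB)).
apply: smallest_sub; last by move=> U oU; exact: rV_measurable_open.
split; first by rewrite /S/= preimage_set0.
- by move=> A SA; rewrite /S/= setTD preimage_setC; exact: measurableC.
- by move=> A SA; rewrite /S/= preimage_bigcup; apply: bigcupT_measurable => n; exact: SA.
Qed.

(** Turns measurability with respect to a generated sigma-algebra into that of
    a function on a measurable type, where closure under operations is
    available. *)
Lemma wrtP {R : realType} {dO : measure_display} {Omega : measurableType dO}
    (G : set (set Omega)) (X : Omega -> R) :
  wrt <<s G >> X <-> measurable_fun (setT : set (g_sigma_algebraType G)) X.
Proof.
split=> [mX _ B mB|mX B mB]; first by rewrite setTI; exact: mX.
by have := mX measurableT B mB; rewrite setTI.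
Qed.

Section Adaptedness.
Context {R : realType} {dO : measure_display} {Omega : measurableType dO}.
Context {P : probability Omega R} {d : nat} {T : R}.
Context {x0 : Omega -> 'rV[R]_d} {W : R -> Omega -> 'rV[R]_d}.
Hypothesis mx0 : random_vector x0.
Hypothesis wW : wiener_process P (generated_filtration x0 W) T W.
Notation F := (generated_filtration x0 W).

Lemma filtration_mono {s t : R} : s <= t -> F s `<=` F t.
Proof.
move=> st; apply: sub_sigma_algebra2 => A [i [B [mB AB]]].
exists i, B; split=> //; case: AB => [->|[r /andP[r0 rs] ->]]; first by left.
by right; exists r => //; rewrite r0 (le_trans rs).
Qed.

Lemma filtration_measurable {t : R} : t <= T -> F t `<=` measurable.
Proof.
move=> tT; apply: smallest_sub; first exact: sigma_algebra_measurable.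
move=> A [i [B [mB [->|[s /andP[s0 st] ->]]]]].
  by rewrite -[X in measurable X]setTI; exact: mx0.
have [/(_ s)] := wW; rewrite s0 (le_trans st tT) => /(_ isT)[mW _] _ _ _.
by rewrite -[X in measurable X]setTI; exact: mW.
Qed.

Lemma vwrt_random_vector {t : R} {X : Omega -> 'rV[R]_d} :
  t <= T -> vwrt (F t) X -> random_vector X.
Proof.
move=> tT FX i _ B mB; rewrite setTI.
by apply: (filtration_measurable tT); exact: FX.
Qed.

Lemma vwrt_mono {s t : R} {X : Omega -> 'rV[R]_d} :
  s <= t -> vwrt (F s) X -> vwrt (F t) X.
Proof. by move=> st FX i B mB; apply: (filtration_mono st); exact: FX. Qed.

Lemma vwrt_wiener (s t : R) : 0 <= s <= t -> t <= T -> vwrt (F t) (W s).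
Proof.
move=> /andP[s0 st] tT; apply: (vwrt_mono (s := s)) => //.
by have [/(_ s)] := wW; rewrite s0 (le_trans st tT) => /(_ isT)[].
Qed.

Lemma vwrt_borel_map {t : R} {f : 'rV[R]_d -> 'rV[R]_d}
    {X : Omega -> 'rV[R]_d} :
  borel_map f -> vwrt (F t) X -> vwrt (F t) (f \o X).
Proof.
move=> bf FX i; apply/wrtP; apply: borel_map_measurable bf _ i => i.
by apply/wrtP; exact: FX.
Qed.

Lemma vwrt_cst (t : R) (c : 'rV[R]_d) : vwrt (F t) (fun=> c).
Proof. by move=> i; apply/wrtP; exact: measurable_cst. Qed.

Lemma vwrtD (t : R) (X Y : Omega -> 'rV[R]_d) :
  vwrt (F t) X -> vwrt (F t) Y -> vwrt (F t) (fun w => X w + Y w).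
Proof.
move=> FX FY i.
rewrite (_ : (fun w => _) = (fun w => X w ord0 i + Y w ord0 i)); last first.
  by apply/funext => w; rewrite mxE.
by apply/wrtP; apply: measurable_funD; apply/wrtP; [exact: FX|exact: FY].
Qed.

Lemma vwrtZ (t c : R) (X : Omega -> 'rV[R]_d) :
  vwrt (F t) X -> vwrt (F t) (fun w => c *: X w).
Proof.
move=> FX i.
rewrite (_ : (fun w => _) = (fun w => c * X w ord0 i)); last first.
  by apply/funext => w; rewrite mxE.
by apply/wrtP; apply: measurable_funM; [exact: measurable_cst|apply/wrtP; exact: FX].
Qed.

Context {mu : R -> 'rV[R]_d -> 'rV[R]_d} (g : R -> R).
Hypothesis T0 : 0 < T.
Hypothesis bmu : forall t, 0 <= t <= T -> borel_map (mu t).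

Lemma grid_mono {K i j : nat} : (i <= j)%N -> grid T K i <= grid T K j.
Proof.
by move=> ij; rewrite /grid ler_wpM2r ?ler_nat// divr_ge0// ltW.
Qed.

Lemma grid_itv {K k : nat} : (0 < K)%N -> (k <= K)%N -> 0 <= grid T K k <= T.
Proof.
move=> K0 kK; apply/andP; split.
  by rewrite mulr_ge0// divr_ge0// ltW.
apply: le_trans (grid_mono kK) _.
by rewrite /grid /step mulrC divfK// pnatr_eq0 -lt0n.
Qed.

Lemma gridS (K k : nat) : grid T K k.+1 - grid T K k = step T K.
Proof. by rewrite /grid -mulrBl -natrB// subSnn mul1r. Qed.

Lemma euler_maruyama_adapted :
  adapted_scheme F T (euler_maruyama T W mu g x0).
Proof.
move=> K + K0; elim=> [_|k ih kK] /=.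
  move=> i B mB; apply: sub_sigma_algebra; exists i, B; split=> //; by left.
have gk := grid_itv K0 (ltnW kK); have /andP[k0 kT] := gk.
have /andP[_ kT'] := grid_itv K0 kK.
have kk' : grid T K k <= grid T K k.+1 by exact: grid_mono.
have {}ih := ih (ltnW kK).
apply: vwrtD; [apply: vwrtD|apply: vwrtZ].
- exact: vwrt_mono kk' ih.
- by apply: vwrtZ; apply: vwrt_mono kk' _; apply: vwrt_borel_map ih; exact: bmu.
- apply: vwrtD; first by apply: vwrt_wiener => //; rewrite (le_trans k0 kk')/=.
  under eq_fun do rewrite -scaleN1r.
  by apply: vwrtZ; apply: vwrt_wiener => //; rewrite k0.
Qed.

Lemma coef_adapted {t : R} {al : seq 'I_d.+1} {X : Omega -> 'rV[R]_d} :
  0 <= t <= T -> (index_set (1 : R) `\ [::]) al -> vwrt (F t) X ->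
  vwrt (F t) (fun w => coef T mu g al t (X w)).
Proof.
move=> tT /index_set1P[[j ->]|[i [j ->]]] FX; last first.
  under eq_fun do rewrite coef_noise2.
  exact: vwrt_cst.
case: (unliftP ord0 j) => [i|] ->.
  under eq_fun do rewrite coef_noise.
  exact: vwrt_cst.
under eq_fun do rewrite coef_time//.
by apply: vwrt_borel_map FX; exact: bmu.
Qed.

End Adaptedness.

(** * Integrals of time-constant integrands *)

Lemma lebesgue_itvcc {R : realType} {s t : R} : s <= t ->
  lebesgue_measure (`[s, t]%classic : set R) = (t - s)%:E.
Proof.
rewrite lebesgue_measure_itv/= lte_fin le_eqVlt => /orP[/eqP ->|->//].
by rewrite ltxx subrr.
Qed.

Section Integrals.
Context {R : realType} {dO : measure_display} {Omega : measurableType dO}.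
Variable P : probability Omega R.

Lemma time_integral_cst (v Z : Omega -> R) (s t : R) :
  s <= t -> measurable_fun setT v -> (forall w, Z w = (t - s) * v w) ->
  time_integral P (fun=> v) s t Z.
Proof.
move=> st mv /funext ->; split; first exact: measurable_funM.
apply: aeW => w; split.
  apply: measurable_bounded_integrable => //.
  - by rewrite [X in (X < _)%E](lebesgue_itvcc st) ltry.
  - by exists `|v w|; split; [exact: num_real|move=> M vM x _ /=; exact: ltW].
rewrite Rintegral_cst// [X in fine X](lebesgue_itvcc st)//=.
by rewrite mulrC.
Qed.

(** Only the events {|V| > n}, which decrease to the empty set, and a null set
    can contribute at rank n. *)
Lemma cvg0_in_probability_eventually0 (V : Omega -> R) (N : set Omega)
    (X : nat -> Omega -> \bar R) :
  measurable_fun setT V -> measurable N -> P N = 0%E ->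
  (forall n, measurable_fun setT (X n)) ->
  (forall n w, ~ N w -> `|V w| <= n%:R -> X n w = 0%E) ->
  cvg0_in_probability P X.
Proof.
move=> mV mN PN mX X0; split=> // e e0.
pose A n := [set w | n%:R < `|V w|].
have mA n : measurable (A n).
  rewrite (_ : A n = setT `&` (fun w => `|V w|) @^-1` `]n%:R, +oo[); last first.
    by rewrite setTI; apply/seteqP; split=> w; rewrite /A/= in_itv/= andbT.
  by apply: (measurableT_comp _ mV) => //; exact: measurable_itv.
have PA : P (A n) @[n --> \oo] --> 0%E.
  have <- : P (\bigcap_n A n) = 0%E.
    rewrite (_ : \bigcap_n _ = set0) ?measure0//.
    apply/seteqP; split=> // w /(_ (Num.truncn `|V w|).+1 I).
    by rewrite /A/= ltNge ltW// truncnS_gt.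
  apply: nonincreasing_cvg_mu => //.
  - by rewrite (le_lt_trans (probability_le1 _ _))// ltry.
  - exact: bigcapT_measurable.
  - move=> m n mn; apply/subsetPset => w; apply: le_lt_trans.
    by rewrite ler_nat.
apply: (squeeze_cvge _ (cvg_cst _) PA).
apply: nearW => n; rewrite measure_ge0/=.
have mXe : measurable [set w | (e%:E <= X n w)%E].
  by rewrite -[X in measurable X]setTI; exact: emeasurable_fun_c_infty.
rewrite -[leRHS]add0e -PN; apply: le_trans (measureU2 _ mN (mA n)).
apply: le_measure; rewrite ?inE//; first exact: measurableU.
move=> w /= eX; have [Nw|Nw] := pselect (N w); [by left|right].
rewrite /A/= ltNge; apply/negP => Vn; move: eX.
by rewrite X0// leNgt lte_fin e0.
Qed.

Let clamp (n : nat) (x : R) : R := Num.max (- n%:R) (Num.min n%:R x).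

Let clamp_id n x : `|x| <= n%:R -> clamp n x = x.
Proof.
by rewrite ler_norml => /andP[nx xn]; rewrite /clamp min_r// max_r.
Qed.

Let clamp_le n x : `|clamp n x| <= n%:R.
Proof.
rewrite ler_norml /clamp le_max lexx/= ge_max ge_min lexx/= andbT.
by rewrite -subr_ge0 opprK addr_ge0.
Qed.

Let measurable_clamp n : measurable_fun setT (clamp n).
Proof.
apply: measurable_maxr; first exact: measurable_cst.
by apply: measurable_minr; [exact: measurable_cst|exact: measurable_id].
Qed.

(** [v] may be unbounded, so the approximating simple processes take the value
    [v] clamped to [[-n, n]].  Where |v| <= n both errors vanish exactly: the
    elementary integral is [v * (B t - B s)], and the processes differ at the
    single time [s], since simple processes live on half-open intervals.  The
    null set [N] leaves the freedom to choose a version [Z] with good paths. *)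
Lemma ito_integral_cst (F : R -> set (set Omega)) (G : set (set Omega))
    (B : R -> Omega -> R) (v Z : Omega -> R) (N : set Omega) (s t : R) :
  s <= t -> F s = <<s G >> -> F s `<=` measurable -> wrt (F s) v ->
  measurable_fun setT (B s) -> measurable_fun setT (B t) ->
  measurable_fun setT Z -> measurable N -> P N = 0%E ->
  (forall w, ~ N w -> Z w = v w * (B t w - B s w)) ->
  ito_integral P F B (fun=> v) s t Z.
Proof.
move=> st FG Fm Fv mBs mBt mZ mN PN ZE.
have mv : measurable_fun setT v.
  by move=> _ A mA; rewrite setTI; apply: Fm; exact: Fv.
have mcv n : measurable_fun setT (fun w => clamp n (v w)).
  exact: measurableT_comp.
split=> //.
  apply: measurable_funTS => /=.
  exact: (measurableT_comp mv measurable_snd).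
pose H n := SimpleProcess 1 (fun i => if i is 0%N then s else t)
  (fun _ w => clamp n (v w)).
have HE n w r : sp_eval (H n) r w = clamp n (v w) * \1_(`]s, t]%classic) r.
  by rewrite /sp_eval big_ord1.
exists H; split.
- move=> n; split=> // -[|//] _; split=> //; last by exists n%:R => w; exact: clamp_le.
  rewrite /= FG; apply/wrtP; apply: (measurableT_comp (measurable_clamp n)).
  by apply/wrtP; rewrite -FG.
- have intE n w : (\int[lebesgue_measure]_(r in `[s, t])
      ((sp_eval (H n) r w - v w) ^+ 2)%:E =
      ((clamp n (v w) - v w) ^+ 2 * (t - s))%:E)%E.
    rewrite EFinM -(lebesgue_itvcc st) -integral_cst//=.
    transitivity (\int[lebesgue_measure]_(r in `]s, t])
      ((clamp n (v w) - v w) ^+ 2)%:E)%E.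
      have HvE r : r \in `]s, t]%classic ->
          ((sp_eval (H n) r w - v w) ^+ 2)%:E = ((clamp n (v w) - v w) ^+ 2)%:E.
        by move=> rst; rewrite HE indicE rst mulr1.
      rewrite -integral_itv_obnd_cbnd; first exact: eq_integral.
      by apply: (eq_measurable_fun (cst ((clamp n (v w) - v w) ^+ 2)%:E)) => // r /HvE.
    by rewrite integral_itv_obnd_cbnd.
  apply: (cvg0_in_probability_eventually0 v set0) => //.
  + move=> n; under eq_fun do rewrite intE.
    apply/measurable_EFinP; apply: measurable_funM => //.
    by apply: measurable_funX; exact: measurable_funB.
  + by move=> n w _ vn; rewrite intE clamp_id// subrr expr0n mul0r.
- have intE n w : sp_int B (H n) w = clamp n (v w) * (B t w - B s w).
    by rewrite /sp_int big_ord1.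
  apply: (cvg0_in_probability_eventually0 v N) => //.
  + move=> n; apply/measurable_EFinP; apply: measurableT_comp => //.
    under eq_fun do rewrite intE.
    apply: measurable_funB => //; apply: measurable_funM => //.
    exact: measurable_funB.
  + by move=> n w Nw vn; rewrite intE clamp_id// ZE// subrr normr0.
Qed.

End Integrals.

(** * The Euler-Maruyama scheme *)

Section Euler.
Context {R : realType} {dO : measure_display} {Omega : measurableType dO}.
Context {P : probability Omega R} {d : nat} {T : R}.
Context {x0 : Omega -> 'rV[R]_d} {W : R -> Omega -> 'rV[R]_d}.
Hypothesis mx0 : random_vector x0.
Hypothesis wW : wiener_process P (generated_filtration x0 W) T W.
Notation F := (generated_filtration x0 W).

Let continuous_scale (A : set R) (f : R -> R) (a : 'rV[R]_d) :
  {within A, continuous f} -> {within A, continuous (fun r => f r *: a)}.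
Proof. by move=> cf r; apply: cvgZr_tmp; exact: cf. Qed.

Lemma multiple_ito_time (s t : R) (v : Omega -> 'rV[R]_d) :
  s <= t -> random_vector v ->
  multiple_ito P F W [:: ord0] v s t (fun w => (t - s) *: v w).
Proof.
move=> st mv; exists (fun r w => (r - s) *: v w); last exact: aeW.
apply: (@iterated_time _ _ _ P d F W (fun=> v) s t [::] (fun=> v)).
- exact: iterated_nil.
- move=> w; apply: continuous_scale; apply: continuous_subspaceT => r.
  by apply: cvgB; [exact: cvg_id|exact: cvg_cst].
- move=> r /andP[sr rt] i.
  by apply: time_integral_cst => // w; rewrite mxE.
Qed.

Let mW (s : R) (j : 'I_d) : 0 <= s <= T ->
  measurable_fun setT (fun w => W s w ord0 j).
Proof. by move=> sT; have [/(_ s sT)[mWs _] _ _ _] := wW; exact: mWs. Qed.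

(** Some paths of [W] may be discontinuous, and the set of these need not be
    measurable; the version is set to 0 on a measurable null set that covers
    it. *)
Lemma multiple_ito_noise (s t : R) (j : 'I_d) (v : Omega -> 'rV[R]_d) :
  0 <= s -> s <= t -> t <= T -> vwrt (F s) v ->
  multiple_ito P F W [:: lift ord0 j] v s t
    (fun w => (W t w ord0 j - W s w ord0 j) *: v w).
Proof.
move=> s0 st tT Fv; have sT := le_trans st tT.
have [_ _ [N [mN PN WN]] _] := wW.
pose Z r w := if w \in N then 0 else (W r w ord0 j - W s w ord0 j) *: v w.
exists Z; last first.
  exists N; split=> // w /=; apply: contra_notP => Nw.
  by rewrite /Z memNset.
apply: (@iterated_ito _ _ _ P d F W (fun=> v) s t [::] j (fun=> v)).
- exact: iterated_nil.
- move=> w; rewrite /Z; case: (boolP (w \in N)) => [_|].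
    by apply: continuous_subspaceT => r; exact: cvg_cst.
  rewrite notin_setE => Nw; apply: continuous_scale.
  have Wc : {within `[0, T], continuous (fun r => W r w)}.
    by apply: contrapT => /WN.
  apply: (@continuous_subspaceW _ _ _ `[0, T]%classic).
    by apply: subset_itv; rewrite bnd_simp.
  move=> r; apply: cvgB; last exact: cvg_cst.
  apply: (@cvg_comp _ _ _ (fun q => W q w) (fun y => y ord0 j) _ _ _ (Wc r)).
  exact: coord_continuous.
- move=> r /andP[sr rt] i.
  have mv : measurable_fun setT (fun w => v w ord0 i).
    exact: (vwrt_random_vector mx0 wW sT Fv).
  have mWs : measurable_fun setT (fun w => W s w ord0 j).
    by apply: mW; rewrite s0.
  have mWr : measurable_fun setT (fun w => W r w ord0 j).
    by apply: mW; rewrite (le_trans s0 sr) (le_trans rt).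
  apply: (ito_integral_cst P F _ _ (fun w => v w ord0 i) _ N) => //.
  + exact: (filtration_measurable mx0 wW sT).
  + rewrite (_ : (fun w => _) = fun w => if w \in N then 0 else
        (W r w ord0 j - W s w ord0 j) * v w ord0 i); last first.
      by apply/funext => w; rewrite /Z; case: ifP; rewrite mxE.
    apply: measurable_fun_ifT => //; last first.
      by apply: measurable_funM => //; exact: measurable_funB.
    apply: (measurable_fun_bool true); rewrite setTI.
    rewrite (_ : _ @^-1` _ = N)//; apply/seteqP; split=> w; first exact: set_mem.
    exact: mem_set.
  + by move=> w Nw; rewrite /Z memNset// mxE mulrC.
Qed.

Lemma multiple_ito_noise2_0 (s t : R) (i j : 'I_d) :
  0 <= s -> s <= t -> t <= T ->
  multiple_ito P F W [:: lift ord0 i; lift ord0 j] (fun=> 0) s t (fun=> 0).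
Proof.
move=> s0 st tT; exists (fun _ _ => 0); last exact: aeW.
have int0 k i' r : s <= r <= t ->
    ito_integral P F (fun q w => W q w ord0 k)
      (fun _ _ => (0 : 'rV[R]_d) ord0 i') s r (fun=> (0 : 'rV[R]_d) ord0 i').
  move=> /andP[sr rt]; have sT := le_trans st tT.
  apply: (ito_integral_cst P F _ _ (fun=> (0 : 'rV[R]_d) ord0 i') _ set0) => //.
  - exact: (filtration_measurable mx0 wW sT).
  - exact: vwrt_cst.
  - by apply: mW; rewrite s0.
  - by apply: mW; rewrite (le_trans s0 sr) (le_trans rt).
  - by move=> w _; rewrite mxE mul0r.
have cont0 (w : Omega) : {within `[s, t], continuous (fun _ : R => (0 : 'rV[R]_d))}.
  by apply: continuous_subspaceT => r; exact: cvg_cst.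
apply: (@iterated_ito _ _ _ P d F W (fun=> fun=> 0) s t [:: lift ord0 i] j
  (fun=> fun=> 0)) => //; last by move=> r sr k; exact: int0.
apply: (@iterated_ito _ _ _ P d F W (fun=> fun=> 0) s t [::] i
  (fun=> fun=> 0)) => //; last by move=> r sr k; exact: int0.
exact: iterated_nil.
Qed.

Variables (mu : R -> 'rV[R]_d -> 'rV[R]_d) (g : R -> R).

(** Closed form of I_al[f_al(s, X)]_{s,t} for the multi-indices of order 1; the
    value 0 for the longer ones is the vanishing of their coefficients. *)
Definition euler_term (s t : R) (X : Omega -> 'rV[R]_d) (al : seq 'I_d.+1)
    (w : Omega) : 'rV[R]_d :=
  if al is [:: j] then
    (if unlift ord0 j is Some i then W t w ord0 i - W s w ord0 i else t - s)
      *: coef T mu g al s (X w)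
  else 0.

Hypothesis T0 : 0 < T.
Hypothesis bmu : forall t, 0 <= t <= T -> borel_map (mu t).

Lemma multiple_ito_euler_term (s t : R) (X : Omega -> 'rV[R]_d) al :
  0 <= s -> s <= t -> t <= T -> vwrt (F s) X ->
  (index_set (1 : R) `\ [::]) al ->
  multiple_ito P F W al (fun w => coef T mu g al s (X w)) s t
    (euler_term s t X al).
Proof.
move=> s0 st tT FX Aal; have sT := le_trans st tT.
have s0T : 0 <= s <= T by rewrite s0.
have Fc := coef_adapted g T0 bmu s0T Aal FX.
have /index_set1P[[j alE]|[i [j ->]]] := Aal; last first.
  under eq_fun do rewrite coef_noise2.
  exact: multiple_ito_noise2_0.
move: Fc; rewrite {}alE /euler_term.
case: (unliftP ord0 j) => [i|] -> Fc; first exact: multiple_ito_noise.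
by apply: multiple_ito_time => //; exact: (vwrt_random_vector mx0 wW sT Fc).
Qed.

(** The sum over the infinite type of multi-indices reduces to the letters,
    where the increment of [W] is expanded in the canonical basis. *)
Lemma sum_euler_term (s t : R) (X : Omega -> 'rV[R]_d) (w : Omega) :
  0 <= s <= T ->
  \sum_(al \in index_set (1 : R) `\ [::]) euler_term s t X al w =
  (t - s) *: mu s (X w) + g s *: (W t w - W s w).
Proof.
move=> sT; pose r : seq (seq 'I_d.+1) := [seq [:: j] | j <- enum 'I_d.+1].
have inr j : [:: j] \in r by apply: map_f; rewrite mem_enum.
rewrite -(fsbig_widen [set` r]).
- rewrite -fsbig_seq; last by rewrite map_inj_uniq ?enum_uniq// => ? ? [].
  rewrite big_map big_enum big_ord_recl/= unlift_none coef_time//; congr (_ + _).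
  rewrite [in RHS](row_sum_delta (W t w - W s w)) scaler_sumr; apply: eq_bigr => i _.
  by rewrite liftK coef_noise !mxE scalerA mulrC -scalerA.
- by move=> _ /mapP[j _ ->]; apply/index_set1P; left; exists j.
- move=> al [/index_set1P[[j ->]|[i [j -> _]]]//].
  by rewrite /= inr.
Qed.

Lemma euler_maruyama_step (K k : nat) (w : Omega) :
  (0 < K)%N -> (k < K)%N ->
  euler_maruyama T W mu g x0 K k.+1 w = euler_maruyama T W mu g x0 K k w +
    \sum_(al \in index_set (1 : R) `\ [::])
      euler_term (grid T K k) (grid T K k.+1) (euler_maruyama T W mu g x0 K k) al w.
Proof.
move=> K0 kK; rewrite sum_euler_term; last exact: grid_itv (ltnW kK).
by rewrite gridS addrA.
Qed.

End Euler.

Theorem lemma3p1 (R : realType) (dO : measure_display)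
    (Omega : measurableType dO) (P : probability Omega R) (d : nat) (T : R)
    (x0 : Omega -> 'rV[R]_d) (W : R -> Omega -> 'rV[R]_d)
    (mu : R -> 'rV[R]_d -> 'rV[R]_d) (g : R -> R) :
  0 < T ->
  random_vector x0 ->
  wiener_process P (generated_filtration x0 W) T W ->
  (forall t : R, 0 <= t <= T -> borel_map (mu t)) ->
  strong_ito_taylor_scheme P (generated_filtration x0 W) T W mu g 1
    (euler_maruyama T W mu g x0) /\
  general_strong_scheme P (generated_filtration x0 W) T W mu g 1
    (euler_maruyama T W mu g x0).
Proof.
move=> T0 mx0 wW bmu.
set x := euler_maruyama T W mu g x0; set F := generated_filtration x0 W.
have Fx : adapted_scheme F T x by exact: (euler_maruyama_adapted wW g T0 bmu).
pose J K al k := euler_term (T := T) (W := W) mu g (grid T K k) (grid T K k.+1) (x K k) al.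
have mJ K k al : (k < K)%N -> (index_set (1 : R) `\ [::]) al ->
    multiple_ito P F W al (fun w => coef T mu g al (grid T K k) (x K k w))
      (grid T K k) (grid T K k.+1) (J K al k).
  move=> kK Aal; have K0 : (0 < K)%N by exact: leq_ltn_trans kK.
  have /andP[k0 _] := grid_itv T0 K0 (ltnW kK).
  have /andP[_ kT] := grid_itv T0 K0 kK.
  apply: multiple_ito_euler_term => //; first exact: grid_mono.
  by apply: Fx => //; exact: ltnW.
split; split=> //.
  move=> K K0; exists (J K) => k kK; split=> [al|]; first exact: mJ.
  by apply: aeW => w; exact: euler_maruyama_step.
exists 0, 0 => K K0.
have sqnorm0 : sqnorm (0 : 'rV[R]_d) = 0.
  by rewrite /sqnorm big1// => i _; rewrite mxE expr0n.
have max0 (I : finType) (f : I -> R) : (forall i, f i = 0) ->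
    \big[Num.max/0]_i f i = 0.
  by move=> f0; elim/big_ind: _ => // a b -> ->; rewrite maxxx.
have maxe0 (I : finType) (f : I -> \bar R) : (forall i, f i = 0%E) ->
    (\big[maxe/0]_i f i = 0)%E.
  by move=> f0; elim/big_ind: _ => // a b -> ->; rewrite maxxx.
exists (fun al k w => coef T mu g al (grid T K k) (x K k w)), (J K),
  (fun _ _ => 0), (fun _ _ => 0); split.
- move=> k kK; split.
  + move=> al Aal; split; last exact: mJ.
    apply: coef_adapted => //; first exact: grid_itv (ltnW kK).
    by apply: Fx => //; exact: ltnW.
  + exact: vwrt_cst.
  + exact: vwrt_cst.
  + by apply: aeW => w; rewrite !addr0; exact: euler_maruyama_step.
  + move=> i; rewrite (_ : (fun w => _) = cst 0); last first.
      by apply/funext => w; rewrite mxE.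
    split=> //; [exact: integrable0|exact: integrable0|].
    by apply/wrtP; exact: measurable_cst.
- move=> al _; rewrite mul0r (_ : (fun w => _) = cst 0) ?expectation_cst//.
  by apply/funext => w; apply: max0 => k; rewrite subrr.
- by rewrite mul0r maxe0// => k; rewrite sqnorm0 expectation_cst.
- by rewrite mul0r maxe0// => k; rewrite sqnorm0 expectation_cst.
Qed.
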